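(* Let $B$ be a ring, $D$ a derivation of $B$, $R=B[X;D]$, and let $f=\sum_{i=0}^m X^i a_i$ ($a_m=1$, $m\ge1$) be a monic polynomial in $B[X;D]_{(0)}$. Let $A=R/fR$ and $x=X+fR\in A$. (1) $f$ is weakly separable in $R$ if and only if the following sequence of $C(A)$-$C(A)$-homomorphisms is exact: \[ V\overset{I_x}{\longrightarrow}V\overset{\tau}{\longrightarrow}C(A). \] (2) $f$ is separable in $R$ if and only if the following sequence of $C(A)$-$C(A)$-homomorphisms is exact: \[ V\overset{I_x}{\longrightarrow}V\overset{\tau}{\longrightarrow}C(A)\longrightarrow 0. \]
   Context: Rings are associative with identity $1$ (not necessarily commutative), and ring extensions share the same identity. A derivation of $B$ is an additive map $D:B\to B$ with $D(\alpha\beta)=D(\alpha)\beta+\alpha D(\beta)$. $R=B[X;D]$ is the skew polynomial ring with multiplication determined by $\alpha X=X\alpha+D(\alpha)$ for $\alpha\in B$; its elements are written uniquely as $\sum_i X^i c_i$ with $c_i\in B$ on the right. $B[X;D]_{(0)}$ is the set of monic polynomials $f\in R$ with $fR=Rf$; for such $f$, $A=R/fR$ is a ring extension of $B$, free with $B$-basis $1,x,\dots,x^{m-1}$. For a ring extension $A/B$: $A/B$ is separable if the $A$-$A$-homomorphism $A\otimes_B A\to A$, $\sum_j z_j\otimes w_j\mapsto\sum_j z_jw_j$, splits (as a homomorphism of $A$-$A$-bimodules). A $B$-derivation of $A$ (to $A$) is an additive map $\delta:A\to A$ with $\delta(zw)=\delta(z)w+z\delta(w)$ for all $z,w\in A$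 and $\delta(B)=\{0\}$; it is inner if there is $m\in A$ with $\delta(z)=mz-zm$ for all $z\in A$. $A/B$ is weakly separable if every $B$-derivation of $A$ to $A$ is inner. The polynomial $f$ is separable (resp. weakly separable) in $R$ if $A=R/fR$ is separable (resp. weakly separable) over $B$. Notation: $C(A)$ is the center of $A$. $V=\{z\in A:\alpha z=z\alpha\ \forall\alpha\in B\}$ is the centralizer of $B$ in $A$. $I_x(z)=zx-xz$ for $z\in A$. For $0\le j\le m-1$, $y_j=\sum_{k=j}^{m-1}x^{k-j}a_{k+1}\in A$, and $\tau(z)=\sum_{j=0}^{m-1}y_jzx^j$ for $z\in A$. The maps in the sequences are the restrictions of $I_x$ and $\tau$ to $V$; $C(A)$ acts by left and right multiplication. *)

(* Defs.v *)
From HB Require Import structures.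
From mathcomp Require Import all_boot all_order all_algebra.
From mathcomp Require Import boolp finmap monalg.

Set Implicit Arguments.
Unset Strict Implicit.
Unset Printing Implicit Defensive.

Import GRing.Theory.
Local Open Scope quotient_scope.
Local Open Scope ring_scope.

(* Rings are [pzRingType]: associative, unital, possibly zero. *)

Definition exact_seq (U V W : zmodType) (g : {additive U -> V})
    (h : {additive V -> W}) : Prop :=
  forall v : V, h v = 0 <-> exists u : U, v = g u.

(* [U -> V -> W -> 0]: exactness at [W] says that [h] is onto. *)
Definition right_exact_seq (U V W : zmodType) (g : {additive U -> V})
    (h : {additive V -> W}) : Prop :=
  exact_seq g h /\ (forall w : W, exists v : V, h v = w).

Record derivation (A : pzRingType) := Derivation {
  der_map :> {additive A -> A};
  derM : forall a b : A, der_map (a * b) = der_map a * b + a * der_map b }.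

Lemma der1 (A : pzRingType) (d : derivation A) : d 1 = 0.
Proof.
apply: (@addrI _ (d 1)); rewrite addr0 -[in RHS](mul1r 1) derM.
by rewrite mulr1 mul1r.
Qed.

Section MalgSum.
Variables (K : choiceType) (G V : zmodType).

Definition malg_sum (h : K -> G -> V) (g : {malg G[K]}) : V :=
  \sum_(k <- msupp g) h k g@_k.

Variable h : K -> G -> V.
Hypothesis hD : forall k, {morph h k : a b / a + b}.

Lemma malg_sum_h0 k : h k 0 = 0.
Proof. by apply: (@addrI _ (h k 0)); rewrite -hD !addr0. Qed.

Lemma malg_sumEw (d : {fset K}) g :
  (msupp g `<=` d)%fset -> malg_sum h g = \sum_(k <- d) h k g@_k.
Proof.
move=> le; rewrite /malg_sum (big_fset_incl _ le) // => k _ nk.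
by rewrite mcoeff_outdom // malg_sum_h0.
Qed.

Lemma malg_sumD : {morph malg_sum h : g1 g2 / g1 + g2}.
Proof.
move=> g1 g2; set d := (msupp g1 `|` msupp g2)%fset.
rewrite (@malg_sumEw d) ?msuppD_le // (@malg_sumEw d g1) ?fsubsetUl //.
rewrite (@malg_sumEw d g2) ?fsubsetUr // -big_split /=.
by apply: eq_bigr => k _; rewrite mcoeffD hD.
Qed.

Lemma malg_sum0 : malg_sum h 0 = 0.
Proof. by apply: (@addrI _ (malg_sum h 0)); rewrite -malg_sumD !addr0. Qed.

Lemma malg_sumB : {morph malg_sum h : g1 g2 / g1 - g2}.
Proof.
by move=> g1 g2; apply: (@addIr _ (malg_sum h g2)); rewrite -malg_sumD !subrK.
Qed.

Lemma malg_sumU k c : malg_sum h << c *g k >> = h k c.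
Proof. by rewrite (malg_sumEw (msuppU_le)) big_seq_fset1 mcoeffUU. Qed.

End MalgSum.

Lemma malg_ind (K : choiceType) (G : zmodType) (P : {malg G[K]} -> Prop) :
  P 0 -> (forall c k p, P p -> P (<< c *g k >> + p)) -> forall p, P p.
Proof.
move=> P0 PD p; rewrite [p]monalgE; elim: (enum_fset _) => [|k s IH].
  by rewrite big_nil.
by rewrite big_cons; apply: PD.
Qed.

(* Skew polynomials, coefficients on the right: << c *g i >> is X^i c. *)
(* {poly B} is not used because it excludes the zero ring.             *)

Section SkewMul.
Variables (B : pzRingType) (D : derivation B).
Local Notation R := {malg B[nat]}.

(* p * X, using (X^i c) X = X^(i+1) c + X^i D(c) *)
Definition skew_mulX (p : R) : R :=
  malg_sum (fun i c => << c *g i.+1 >> + << D c *g i >> : R) p.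

Definition skew_mulC (p : R) (b : B) : R :=
  malg_sum (fun i c => << c * b *g i >> : R) p.

(* p * (\sum_i X^i c_i) = \sum_i (p X^i) c_i *)
Definition skew_mul (p q : R) : R :=
  malg_sum (fun i c => skew_mulC (iter i skew_mulX p) c) q.

Lemma skew_mulXD : {morph skew_mulX : p q / p + q}.
Proof.
apply: malg_sumD => k a b /=.
by rewrite !raddfD /= addrACA.
Qed.

Lemma skew_mulXU c i : skew_mulX << c *g i >> = << c *g i.+1 >> + << D c *g i >>.
Proof.
rewrite /skew_mulX malg_sumU // => k a b /=.
by rewrite !raddfD /= addrACA.
Qed.

Lemma skew_mulCD b : {morph skew_mulC^~ b : p q / p + q}.
Proof. by apply: malg_sumD => k a c /=; rewrite mulrDl raddfD. Qed.

Lemma skew_mulCU b c i : skew_mulC << c *g i >> b = << c * b *g i >>.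
Proof. by rewrite /skew_mulC malg_sumU // => k a d /=; rewrite mulrDl raddfD. Qed.

Lemma skew_mulC0 b : skew_mulC 0 b = 0.
Proof. by apply: malg_sum0 => k a c /=; rewrite mulrDl raddfD. Qed.

Lemma skew_mulX0 : skew_mulX 0 = 0.
Proof. by apply: malg_sum0 => k a c /=; rewrite !raddfD /= addrACA. Qed.

Lemma skew_mulCDr p : {morph skew_mulC p : a b / a + b}.
Proof.
move=> a b; elim/malg_ind: p => [|c k p IH]; first by rewrite !skew_mulC0 addr0.
by rewrite !skew_mulCD IH !skew_mulCU mulrDr raddfD /= addrACA.
Qed.

Lemma skew_mulDr p : {morph skew_mul p : q r / q + r}.
Proof. by apply: malg_sumD => k a b; rewrite skew_mulCDr. Qed.

Lemma skew_mulU p c i :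
  skew_mul p << c *g i >> = skew_mulC (iter i skew_mulX p) c.
Proof. by rewrite /skew_mul malg_sumU // => k a b; rewrite skew_mulCDr. Qed.

Lemma skew_mul0 p : skew_mul p 0 = 0.
Proof. by apply: malg_sum0 => k a b; rewrite skew_mulCDr. Qed.

Lemma iter_skew_mulXD i : {morph iter i skew_mulX : p q / p + q}.
Proof.
elim: i => [//|i IH] p q; rewrite !iterS; apply: etrans (skew_mulXD _ _).
by congr skew_mulX; apply: IH.
Qed.

Lemma skew_mulDl : left_distributive skew_mul +%R.
Proof.
move=> p q r; elim/malg_ind: r => [|c k r IH]; first by rewrite !skew_mul0 addr0.
by rewrite !skew_mulDr IH !skew_mulU iter_skew_mulXD skew_mulCD addrACA.
Qed.

Lemma skew_mulX_mulC p b :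
  skew_mulX (skew_mulC p b) = skew_mulC (skew_mulX p) b + skew_mulC p (D b).
Proof.
elim/malg_ind: p => [|c k p IH].
  by rewrite !(skew_mulC0, skew_mulX0) addr0.
rewrite !(skew_mulCD, skew_mulXD) IH !(skew_mulCU, skew_mulXU) skew_mulCD.
rewrite !skew_mulCU derM raddfD /= -!addrA; congr (_ + (_ + _)).
by rewrite addrCA.
Qed.

Lemma skew_mulC_mulC p a b : skew_mulC (skew_mulC p a) b = skew_mulC p (a * b).
Proof.
elim/malg_ind: p => [|c k p IH]; first by rewrite !skew_mulC0.
by rewrite !skew_mulCD !skew_mulCU IH mulrA.
Qed.

Lemma skew_mul_mulC p q b : skew_mul p (skew_mulC q b) = skew_mulC (skew_mul p q) b.
Proof.
elim/malg_ind: q => [|c k q IH]; first by rewrite !(skew_mul0, skew_mulC0).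
by rewrite !(skew_mulCD, skew_mulDr) IH skew_mulCU !skew_mulU skew_mulC_mulC.
Qed.

Lemma skew_mul_mulX p q : skew_mul p (skew_mulX q) = skew_mulX (skew_mul p q).
Proof.
elim/malg_ind: q => [|c k q IH]; first by rewrite !(skew_mul0, skew_mulX0).
rewrite !(skew_mulXD, skew_mulDr) IH skew_mulXU skew_mulDr !skew_mulU.
by rewrite skew_mulX_mulC iterS.
Qed.

Lemma skew_mulA : associative skew_mul.
Proof.
move=> p q r; elim/malg_ind: r => [|c k r IH]; first by rewrite !skew_mul0.
rewrite !skew_mulDr IH !skew_mulU skew_mul_mulC; congr (skew_mulC _ _ + _).
by elim: k => //= k IHk; rewrite skew_mul_mulX IHk.
Qed.

Definition skew_one : R := << 1 *g 0%N >>.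

Lemma skew_mulp1 : right_id skew_one skew_mul.
Proof.
move=> p; rewrite skew_mulU /=.
elim/malg_ind: p => [|c k p IH]; first by rewrite skew_mulC0.
by rewrite skew_mulCD IH skew_mulCU mulr1.
Qed.

Lemma iter_skew_mulX1 i : iter i skew_mulX skew_one = << 1 *g i >>.
Proof. by elim: i => //= i ->; rewrite skew_mulXU der1 raddf0 addr0. Qed.

Lemma skew_mul1p : left_id skew_one skew_mul.
Proof.
move=> p; elim/malg_ind: p => [|c k p IH]; first by rewrite skew_mul0.
by rewrite skew_mulDr IH skew_mulU iter_skew_mulX1 skew_mulCU mul1r.
Qed.

End SkewMul.

Definition skewpoly (B : pzRingType) (D : derivation B) := {malg B[nat]}.

Section SkewPoly.
Variables (B : pzRingType) (D : derivation B).
Local Notation R := (skewpoly D).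

HB.instance Definition _ := GRing.Zmodule.on R.
HB.instance Definition _ := GRing.Zmodule_isPzRing.Build R
  (skew_mulA D) (skew_mul1p D) (@skew_mulp1 B D) (skew_mulDl D) (skew_mulDr D).

Lemma skewpoly_mulE (p q : R) : p * q = skew_mul D p q.
Proof. by []. Qed.

Definition skewC (b : B) : R := << b *g 0%N >>.
Definition skewX : R := << 1 *g 1%N >>.

Lemma skewC_is_zmod_morphism : zmod_morphism skewC.
Proof. by move=> a b; rewrite /skewC raddfB. Qed.

Lemma skewC_is_monoid_morphism : monoid_morphism skewC.
Proof.
split=> // a b; rewrite skewpoly_mulE /skewC.
by rewrite (skew_mulU D) /= skew_mulCU.
Qed.

HB.instance Definition _ :=
  GRing.isZmodMorphism.Build B R skewC skewC_is_zmod_morphism.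
HB.instance Definition _ :=
  GRing.isMonoidMorphism.Build B R skewC skewC_is_monoid_morphism.

Lemma skew_mul_X (p : R) : p * skewX = skew_mulX D p.
Proof. by rewrite skewpoly_mulE -[RHS](skew_mulp1 D) !(skew_mulU D). Qed.

Lemma skewCX b : skewC b * skewX = skewX * skewC b + skewC (D b).
Proof.
rewrite skew_mul_X skew_mulXU; congr (_ + _).
by rewrite skewpoly_mulE (skew_mulU D) /= skew_mulCU mul1r.
Qed.

Lemma skewXnC i c : skewX ^+ i * skewC c = << c *g i >>.
Proof.
have -> : skewX ^+ i = << 1 *g i >>.
  elim: i => [|i IH]; first by rewrite expr0.
  by rewrite exprSr IH skew_mul_X skew_mulXU der1 raddf0 addr0.
by rewrite skewpoly_mulE (skew_mulU D) /= skew_mulCU mul1r.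
Qed.

Definition skewcoef (i : nat) (p : R) : B := p@_i.

Lemma skewpolyE (p : R) :
  p = \sum_(i <- msupp p) skewX ^+ i * skewC (skewcoef i p).
Proof. by rewrite {1}[p]monalgE; apply: eq_bigr => i _; rewrite skewXnC. Qed.

Lemma skewpolyP (p q : R) : (forall i, skewcoef i p = skewcoef i q) <-> p = q.
Proof. exact: malgP. Qed.

Lemma skewcoef_is_zmod_morphism i : zmod_morphism (skewcoef i).
Proof. by move=> p q; apply: (mcoeffB i p q). Qed.

HB.instance Definition _ i :=
  GRing.isZmodMorphism.Build R B (skewcoef i) (skewcoef_is_zmod_morphism i).

Lemma skewpoly_ind (P : R -> Prop) :
  P 0 -> (forall c i p, P p -> P (skewX ^+ i * skewC c + p)) -> forall p, P p.
Proof. by move=> P0 PD p; apply: malg_ind => // c i q; rewrite -skewXnC; apply: PD. Qed.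

Lemma skewcoefXnC i c j : skewcoef j (skewX ^+ i * skewC c) = c *+ (i == j).
Proof. by rewrite skewXnC /skewcoef mcoeffU. Qed.

Lemma skewpoly_coefE n (c : nat -> B) j :
  skewcoef j (\sum_(i < n) skewX ^+ i * skewC (c i)) = if (j < n)%N then c j else 0.
Proof.
rewrite (raddf_sum (skewcoef j)) /=.
under eq_bigr => i _ do rewrite skewcoefXnC.
case: ltnP => [jn|nj].
  rewrite (bigD1 (Ordinal jn)) //= eqxx big1 ?addr0 // => i.
  by rewrite -val_eqE /= => /negPf->.
by rewrite big1 // => i _; rewrite (ltn_eqF (leq_trans (ltn_ord i) nj)).
Qed.

(* [p] has degree at most [n], with coefficient [c] at [X^n] *)
Definition skewtop n c (p : R) : Prop :=
  skewcoef n p = c /\ forall i, (n < i)%N -> skewcoef i p = 0.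

Definition monic_of_degree (m : nat) (p : R) : Prop := skewtop m 1 p.

Lemma skewtopE n c p : skewtop n c p ->
  p = \sum_(i < n.+1) skewX ^+ i * skewC (skewcoef i p).
Proof.
move=> [_ p0]; apply/skewpolyP => j; rewrite (skewpoly_coefE _ (skewcoef^~ p)).
by case: ltnP => // /p0.
Qed.

Lemma skewtop_ex (p : R) : exists n, skewtop n (skewcoef n p) p.
Proof.
exists (\max_(i <- msupp p) i)%N; split=> // i; rewrite ltnNge => lt.
apply/eqP; rewrite /skewcoef mcoeff_eq0; apply: contra lt => ip.
exact: (@leq_bigmax_seq _ _ xpredT id).
Qed.

Lemma skewcoefMC p b i : skewcoef i (p * skewC b) = skewcoef i p * b.
Proof.
elim/skewpoly_ind: p => [|c k p IH]; first by rewrite mul0r !raddf0 mul0r.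
rewrite mulrDl !(raddfD (skewcoef i)) /= IH mulrDl -mulrA -rmorphM.
by rewrite !skewcoefXnC mulrnAl.
Qed.

Lemma skewcoefXM p i :
  skewcoef i (skewX * p) = if i is i'.+1 then skewcoef i' p else 0.
Proof.
elim/skewpoly_ind: p => [|c k p IH].
  by rewrite mulr0; case: i => *; rewrite !raddf0.
rewrite mulrDr (raddfD (skewcoef i)) /= IH mulrA -exprS skewcoefXnC.
by case: i {IH} => [|i]; rewrite ?addr0 // (raddfD (skewcoef i)) /= skewcoefXnC.
Qed.

Lemma skewcoefMX p i :
  skewcoef i (p * skewX) =
  (if i is i'.+1 then skewcoef i' p else 0) + D (skewcoef i p).
Proof.
elim/skewpoly_ind: p => [|c k p IH].
  by rewrite mul0r; case: i => *; rewrite !raddf0 addr0.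
rewrite mulrDl (raddfD (skewcoef i)) /= IH -mulrA skewCX mulrDr mulrA -exprSr.
rewrite !(raddfD (skewcoef i)) /= !skewcoefXnC raddfD raddfMn /= addrACA.
congr (_ + _); case: i {IH} => [|i]; first by rewrite addr0.
by rewrite (raddfD (skewcoef i)) /= skewcoefXnC.
Qed.

Lemma skewtopMXn n c p k : skewtop n c p -> skewtop (n + k) c (p * skewX ^+ k).
Proof.
move=> top; elim: k => [|k [IH1 IH2]]; first by rewrite addn0 expr0 mulr1.
rewrite exprSr mulrA addnS; split=> [|[//|i] lt]; rewrite skewcoefMX.
  by rewrite IH1 IH2 ?ltnS // raddf0 addr0.
by rewrite IH2 // IH2 ?raddf0 ?addr0 // ltnW.
Qed.

Lemma skewtopM n a p m c q :
  skewtop n a p -> skewtop m c q -> skewtop (n + m) (a * c) (p * q).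
Proof.
move=> tp tq; have [qm _] := tq.
have coefM j : (n + m <= j)%N ->
    skewcoef j (p * q) = skewcoef j (p * skewX ^+ m) * c.
  move=> le; rewrite {1}(skewtopE tq) mulr_sumr (raddf_sum (skewcoef j)) /=.
  rewrite big_ord_recr /= big1 ?add0r; first by rewrite mulrA skewcoefMC qm.
  move=> i _; rewrite mulrA skewcoefMC (skewtopMXn i tp).2 ?mul0r //.
  by apply: leq_trans le; rewrite ltn_add2l.
have [t1 t2] := skewtopMXn m tp.
by split=> [|j lt]; rewrite coefM ?(ltnW lt) // ?t1 // t2 ?mul0r.
Qed.

Lemma skewtop_quot m k f r a : monic_of_degree m f ->
  skewtop (m + k) a (f * r) -> skewtop k a r.
Proof.
move=> tf [tfr1 tfr2]; have [n] := skewtop_ex r.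
have top_le n' : skewtop n' (skewcoef n' r) r -> (k < n')%N -> skewcoef n' r = 0.
  by move=> t lt; rewrite -[LHS]mul1r -(skewtopM tf t).1 tfr2 // ltn_add2l.
have {top_le} deg: forall n, skewtop n (skewcoef n r) r ->
    forall i, (k < i)%N -> skewcoef i r = 0.
  elim=> [|n' IH] t i ki; first by have [_ ->] := t; rewrite // (leq_trans _ ki).
  have [kn|nk] := ltnP k n'.+1; last by apply: t.2; apply: leq_ltn_trans ki.
  apply: IH ki; split=> // j; rewrite leq_eqVlt => /predU1P[<-|]; last exact: t.2.
  exact: top_le.
move=> t; have rk : skewtop k (skewcoef k r) r by split=> //; apply: deg t.
by have [] := skewtopM tf rk; rewrite tfr1 mul1r => ->.
Qed.

Lemma skewtopC a : skewtop 0 a (skewC a).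
Proof.
by split=> [|[//|i] _]; rewrite -[skewC a]mul1r -(expr0 skewX) skewcoefXnC.
Qed.

Lemma skewtopX : skewtop 1 1 skewX.
Proof.
have skewXE : skewX = skewX ^+ 1 * skewC 1 by rewrite expr1 rmorph1 mulr1.
by split=> [|[|[|i]] // _]; rewrite skewXE skewcoefXnC.
Qed.

End SkewPoly.

(* The ring quotients of [ring_quotient] require a commutative ring; this *)
(* puts a product on its additive quotient by a two-sided ideal.          *)

Record ideal2 (R : pzRingType) := Ideal2 {
  ideal2_sub :> zmodClosed R;
  ideal2Ml : forall a x : R, x \in ideal2_sub -> a * x \in ideal2_sub;
  ideal2Mr : forall a x : R, x \in ideal2_sub -> x * a \in ideal2_sub }.

Definition ringquot (R : pzRingType) (I : ideal2 R) := {ideal_quot I}.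

Section RingQuot.
Variables (R : pzRingType) (I : ideal2 R).
Local Notation Q := (ringquot I).

HB.instance Definition _ := GRing.Zmodule.on Q.

Definition rqpi (a : R) : Q := \pi_({ideal_quot I}) a.
Definition rqrepr (x : Q) : R := repr (x : {ideal_quot I}).

Lemma rqreprK : cancel rqrepr rqpi.
Proof. exact: reprK. Qed.

Lemma rqpi_eqP a b : rqpi a = rqpi b <-> a - b \in (I : zmodClosed R).
Proof. by rewrite Quotient.idealrBE; split=> [?|/eqP]; first apply/eqP. Qed.

Lemma rqpi_is_zmod_morphism : zmod_morphism rqpi.
Proof. exact: (raddfB (\pi_({ideal_quot I}))). Qed.

HB.instance Definition _ :=
  GRing.isZmodMorphism.Build R Q rqpi rqpi_is_zmod_morphism.

Definition rqmul (x y : Q) : Q := rqpi (rqrepr x * rqrepr y).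

Lemma rqmul_pi a b : rqmul (rqpi a) (rqpi b) = rqpi (a * b).
Proof.
apply/rqpi_eqP; set a' := rqrepr _; set b' := rqrepr _.
have -> : a' * b' - a * b = (a' - a) * b' + a * (b' - b).
  by rewrite mulrBl mulrBr addrA subrK.
by apply: rpredD; [apply: ideal2Mr|apply: ideal2Ml]; apply/rqpi_eqP; rewrite rqreprK.
Qed.

Lemma rqmulA : associative rqmul.
Proof.
move=> x y z; rewrite -[x]rqreprK -[y]rqreprK -[z]rqreprK.
by rewrite !rqmul_pi mulrA.
Qed.

Lemma rqmul1x : left_id (rqpi 1) rqmul.
Proof. by move=> x; rewrite -[x]rqreprK rqmul_pi mul1r. Qed.

Lemma rqmulx1 : right_id (rqpi 1) rqmul.
Proof. by move=> x; rewrite -[x]rqreprK rqmul_pi mulr1. Qed.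

Lemma rqmulDl : left_distributive rqmul +%R.
Proof.
move=> x y z; rewrite -[x]rqreprK -[y]rqreprK -[z]rqreprK.
by rewrite -raddfD !rqmul_pi mulrDl raddfD.
Qed.

Lemma rqmulDr : right_distributive rqmul +%R.
Proof.
move=> x y z; rewrite -[x]rqreprK -[y]rqreprK -[z]rqreprK.
by rewrite -raddfD !rqmul_pi mulrDr raddfD.
Qed.

HB.instance Definition _ := GRing.Zmodule_isPzRing.Build Q
  rqmulA rqmul1x rqmulx1 rqmulDl rqmulDr.

Lemma rqpi_is_monoid_morphism : monoid_morphism rqpi.
Proof. by split=> // a b; rewrite -rqmul_pi. Qed.

HB.instance Definition _ :=
  GRing.isMonoidMorphism.Build R Q rqpi rqpi_is_monoid_morphism.

End RingQuot.


Definition normal_elt (R : pzRingType) (f : R) : Prop :=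
  forall p : R, (exists q, p = f * q) <-> (exists q, p = q * f).

Section PrincipalIdeal.
Variables (R : pzRingType) (f : R).

Definition rideal_pred : {pred R} := [pred p | `[< exists q, p = f * q >]].

Lemma rideal_predP p : reflect (exists q, p = f * q) (p \in rideal_pred).
Proof. exact: asboolP. Qed.

Lemma rideal_zmod_closed : zmod_closed rideal_pred.
Proof.
split=> [|p q /rideal_predP[a ->] /rideal_predP[b ->]]; apply/rideal_predP.
  by exists 0; rewrite mulr0.
by exists (a - b); rewrite mulrBr.
Qed.

HB.instance Definition _ := GRing.isZmodClosed.Build R rideal_pred rideal_zmod_closed.

Definition rideal : zmodClosed R := rideal_pred.

Hypothesis fN : normal_elt f.

Lemma ridealMl a p : p \in rideal -> a * p \in rideal.
Proof.
move=> /rideal_predP/(fN p)[q ->]; apply/rideal_predP/fN.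
by exists (a * q); rewrite mulrA.
Qed.

Lemma ridealMr a p : p \in rideal -> p * a \in rideal.
Proof.
move=> /rideal_predP[q ->]; apply/rideal_predP.
by exists (q * a); rewrite mulrA.
Qed.

Definition normal_ideal : ideal2 R := Ideal2 ridealMl ridealMr.

End PrincipalIdeal.

(* An extension A/B is given by iota : B -> A; the notions below only *)
(* depend on the subring iota(B) of A.                                *)

Section Centralizer.
Variables (B A : pzRingType) (iota : {rmorphism B -> A}).

Definition centralizer_pred : {pred A} :=
  [pred z | `[< forall b : B, iota b * z = z * iota b >]].

Lemma centralizer_predP z :
  reflect (forall b : B, iota b * z = z * iota b) (z \in centralizer_pred).
Proof. exact: asboolP. Qed.

Lemma centralizer_zmod_closed : zmod_closed centralizer_pred.
Proof.
split=> [|x y /centralizer_predP cx /centralizer_predP cy];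
  apply/centralizer_predP => b; first by rewrite mulr0 mul0r.
by rewrite mulrBl mulrBr cx cy.
Qed.

HB.instance Definition _ :=
  GRing.isZmodClosed.Build A centralizer_pred centralizer_zmod_closed.

Record centralizer := Centralizer {
  centralizer_val : A;
  _ : centralizer_val \in centralizer_pred }.

HB.instance Definition _ := [isSub for centralizer_val].
HB.instance Definition _ := [Choice of centralizer by <:].
HB.instance Definition _ := [SubChoice_isSubZmodule of centralizer by <:].

Lemma centralizerP (z : centralizer) (b : B) : iota b * val z = val z * iota b.
Proof. by case: z => z /= /centralizer_predP. Qed.

End Centralizer.

Definition center (A : pzRingType) := centralizer (idfun : {rmorphism A -> A}).
HB.instance Definition _ (A : pzRingType) := GRing.Zmodule.on (center A).

Section Tensor.
Variables (B A : pzRingType) (iota : {rmorphism B -> A}).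

(* The subgroup of the free abelian group on A * A generated by the     *)
(* relations that define the tensor product over B.                     *)
Inductive tensor_rel : {malg int[(A * A)%type]} -> Prop :=
| TensorRel0 : tensor_rel 0
| TensorRelB g h : tensor_rel g -> tensor_rel h -> tensor_rel (g - h)
| TensorRelDl z1 z2 w :
    tensor_rel (<< (z1 + z2, w) >> - (<< (z1, w) >> + << (z2, w) >>))
| TensorRelDr z w1 w2 :
    tensor_rel (<< (z, w1 + w2) >> - (<< (z, w1) >> + << (z, w2) >>))
| TensorRelM z b w : tensor_rel (<< (z * iota b, w) >> - << (z, iota b * w) >>).

Definition tensor_rel_pred : {pred {malg int[(A * A)%type]}} :=
  [pred g | `[< tensor_rel g >]].

Lemma tensor_rel_zmod_closed : zmod_closed tensor_rel_pred.
Proof.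
split=> [|g h /asboolP rg /asboolP rh]; apply/asboolP; first exact: TensorRel0.
exact: TensorRelB.
Qed.

HB.instance Definition _ :=
  GRing.isZmodClosed.Build {malg int[(A * A)%type]} tensor_rel_pred tensor_rel_zmod_closed.

Definition tensor_sub : zmodClosed {malg int[(A * A)%type]} := tensor_rel_pred.

Definition tensor := {ideal_quot tensor_sub}.
HB.instance Definition _ := GRing.Zmodule.on tensor.

Definition tensor_pi (g : {malg int[(A * A)%type]}) : tensor := \pi_({ideal_quot tensor_sub}) g.
Definition tensor_pure (z w : A) : tensor := tensor_pi << (z, w) >>.

Local Notation "z ⊗ w" := (tensor_pure z w) (at level 40).

Lemma tensor_pi_is_zmod_morphism : zmod_morphism tensor_pi.
Proof. exact: (raddfB (\pi_({ideal_quot tensor_sub}))). Qed.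

HB.instance Definition _ := GRing.isZmodMorphism.Build {malg int[(A * A)%type]} tensor
  tensor_pi tensor_pi_is_zmod_morphism.

Definition tensor_repr (t : tensor) : {malg int[(A * A)%type]} :=
  repr (t : {ideal_quot tensor_sub}).

Lemma tensor_reprK : cancel tensor_repr tensor_pi.
Proof. exact: reprK. Qed.

Lemma tensor_pi_eqP g h : tensor_pi g = tensor_pi h <-> tensor_rel (g - h).
Proof.
apply: (iff_trans (B := g - h \in tensor_sub)); last by split=> /asboolP.
by rewrite Quotient.idealrBE; split=> [?|/eqP]; first apply/eqP.
Qed.

Lemma tensorDl z1 z2 w : (z1 + z2) ⊗ w = z1 ⊗ w + z2 ⊗ w.
Proof. by rewrite -raddfD; apply/tensor_pi_eqP/TensorRelDl. Qed.

Lemma tensorDr z w1 w2 : z ⊗ (w1 + w2) = z ⊗ w1 + z ⊗ w2.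
Proof. by rewrite -raddfD; apply/tensor_pi_eqP/TensorRelDr. Qed.

Lemma tensorM z b w : (z * iota b) ⊗ w = z ⊗ (iota b * w).
Proof. exact/tensor_pi_eqP/TensorRelM. Qed.

Lemma tensor_ind (P : tensor -> Prop) :
  P 0 -> (forall t u, P t -> P u -> P (t - u)) -> (forall z w, P (z ⊗ w)) ->
  forall t, P t.
Proof.
move=> P0 PB Pp t; rewrite -(tensor_reprK t).
have PN u : P u -> P (- u) by move=> Pu; rewrite -sub0r; apply: PB.
have PD u v : P u -> P v -> P (u + v).
  by move=> Pu Pv; rewrite -[v]opprK; apply: PB => //; apply: PN.
have Pn u n : P u -> P (u *+ n).
  by move=> Pu; elim: n => [|n IHn]; rewrite ?mulr0n // mulrS; apply: PD.
have Pz u (c : int) : P u -> P (u *~ c).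
  move=> Pu; case: c => n; first exact: Pn.
  by rewrite NegzE mulrNz; apply/PN/Pn.
elim/malg_ind: (tensor_repr t) => [|c [z w] g IH]; first by rewrite raddf0.
rewrite raddfD; apply: PD => //.
have -> : << c *g (z, w) >> = << (z, w) >> *~ c :> {malg int[(A * A)%type]}.
  apply/malgP => k; rewrite mcoeffU raddfMz /= mcoeffU.
  by case: eqP => _; rewrite ?mul0rz // mulr1n intz.
by rewrite raddfMz; apply: Pz; apply: Pp.
Qed.

(* The additive map out of the tensor product induced by a balanced map. *)
Section Lift.
Variables (G : zmodType) (phi : A -> A -> G).

Definition tensor_lift (t : tensor) : G :=
  malg_sum (fun zw n => phi zw.1 zw.2 *~ n) (tensor_repr t).

Hypothesis phiDl : forall z1 z2 w, phi (z1 + z2) w = phi z1 w + phi z2 w.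
Hypothesis phiDr : forall z w1 w2, phi z (w1 + w2) = phi z w1 + phi z w2.
Hypothesis phiM : forall z b w, phi (z * iota b) w = phi z (iota b * w).

Local Notation lift0 := (malg_sum (fun zw n => phi zw.1 zw.2 *~ n)).

Lemma tensor_lift_pi g : tensor_lift (tensor_pi g) = lift0 g.
Proof.
have hD : forall k : (A * A)%type, {morph (fun n => phi k.1 k.2 *~ n) : a b / a + b}.
  by move=> k a b; rewrite mulrzDr.
have lift0U z w : lift0 << (z, w) >> = phi z w by rewrite malg_sumU.
apply/eqP; rewrite -subr_eq0 -malg_sumB //; apply/eqP.
have: tensor_rel (tensor_repr (tensor_pi g) - g).
  by apply/tensor_pi_eqP; rewrite tensor_reprK.
elim=> [|a b _ IHa _ IHb|z1 z2 w|z w1 w2|z b w].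
- exact: malg_sum0.
- by rewrite malg_sumB // IHa IHb subrr.
- by rewrite malg_sumB // malg_sumD // !lift0U phiDl subrr.
- by rewrite malg_sumB // malg_sumD // !lift0U phiDr subrr.
- by rewrite malg_sumB // !lift0U phiM subrr.
Qed.

Lemma tensor_lift_pure z w : tensor_lift (z ⊗ w) = phi z w.
Proof. by rewrite tensor_lift_pi malg_sumU // => k a b; rewrite mulrzDr. Qed.

Lemma tensor_liftB : {morph tensor_lift : t u / t - u}.
Proof.
move=> t u; rewrite -(tensor_reprK t) -(tensor_reprK u) -raddfB !tensor_lift_pi.
by rewrite malg_sumB // => k a b; rewrite mulrzDr.
Qed.

End Lift.

(* The A-A-bimodule structure: a (z ⊗ w) = az ⊗ w, (z ⊗ w) a = z ⊗ wa. *)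
Definition tensor_lact (a : A) : tensor -> tensor :=
  tensor_lift (fun z w => (a * z) ⊗ w).
Definition tensor_ract (t : tensor) (a : A) : tensor :=
  tensor_lift (fun z w => z ⊗ (w * a)) t.

(* z ⊗ w |-> zw *)
Definition tensor_mult : tensor -> A := tensor_lift (fun z w => z * w).

Lemma tensor_lact_pure a z w : tensor_lact a (z ⊗ w) = (a * z) ⊗ w.
Proof.
apply: tensor_lift_pure => *; first by rewrite mulrDr tensorDl.
  by rewrite tensorDr.
by rewrite mulrA tensorM.
Qed.

Lemma tensor_lactB a : {morph tensor_lact a : t u / t - u}.
Proof.
apply: tensor_liftB => *; first by rewrite mulrDr tensorDl.
  by rewrite tensorDr.
by rewrite mulrA tensorM.
Qed.

Lemma tensor_ract_pure a z w : tensor_ract (z ⊗ w) a = z ⊗ (w * a).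
Proof.
apply: tensor_lift_pure => *; first by rewrite tensorDl.
  by rewrite mulrDl tensorDr.
by rewrite -mulrA tensorM.
Qed.

Lemma tensor_ractB a : {morph tensor_ract^~ a : t u / t - u}.
Proof.
apply: tensor_liftB => *; first by rewrite tensorDl.
  by rewrite mulrDl tensorDr.
by rewrite -mulrA tensorM.
Qed.

Lemma tensor_mult_pure z w : tensor_mult (z ⊗ w) = z * w.
Proof. by apply: tensor_lift_pure => *; rewrite ?(mulrDl, mulrDr, mulrA). Qed.

Lemma tensor_multB : {morph tensor_mult : t u / t - u}.
Proof. by apply: tensor_liftB => *; rewrite ?(mulrDl, mulrDr, mulrA). Qed.

Definition separable : Prop :=
  exists s : {additive A -> tensor},
    [/\ forall a z : A, s (a * z) = tensor_lact a (s z),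
        forall z a : A, s (z * a) = tensor_ract (s z) a
      & forall z : A, tensor_mult (s z) = z].

End Tensor.

Definition inner_derivation (A : pzRingType) (d : derivation A) : Prop :=
  exists m : A, forall z : A, d z = m * z - z * m.

Definition weakly_separable (B A : pzRingType) (iota : {rmorphism B -> A}) : Prop :=
  forall d : derivation A, (forall b : B, d (iota b) = 0) -> inner_derivation d.


(* The elements of degree m of B[X; D]_(0). *)
Record skewpoly0 (B : pzRingType) (D : derivation B) (m : nat) := Skewpoly0 {
  sp0_poly :> skewpoly D;
  sp0_monic : monic_of_degree m sp0_poly;
  sp0_normal : normal_elt sp0_poly }.

Section NormalMonic.
Variables (B : pzRingType) (D : derivation B) (m : nat) (f : skewpoly0 D m).

Lemma sp0_commC b : skewC D b * sp0_poly f = sp0_poly f * skewC D b.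
Proof.
have [r e] : exists r, skewC D b * sp0_poly f = sp0_poly f * r by apply/sp0_normal; exists (skewC D b).
have t : skewtop (m + 0) b (sp0_poly f * r).
  rewrite -e -[X in skewtop _ X]mulr1 addnC.
  by apply: skewtopM (sp0_monic f); apply: skewtopC.
have tr := skewtop_quot (sp0_monic f) t.
by rewrite e (skewtopE tr) big_ord1 expr0 mul1r tr.1.
Qed.

Lemma sp0_commX : skewX D * sp0_poly f = sp0_poly f * skewX D.
Proof.
have [r e] : exists r, skewX D * sp0_poly f = sp0_poly f * r by apply/sp0_normal; exists (skewX D).
have t : skewtop (m + 1) 1 (sp0_poly f * r).
  rewrite -e -[X in skewtop _ X]mulr1 addnC.
  by apply: skewtopM (sp0_monic f); apply: skewtopX.
have tr := skewtop_quot (sp0_monic f) t.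
have def_r : r = skewC D (skewcoef 0 r) + skewX D.
  rewrite {1}(skewtopE tr) big_ord_recl big_ord1 expr0 mul1r expr1 tr.1.
  by rewrite rmorph1 mulr1.
have [fm fgt] := sp0_monic f.
suff r0 : skewcoef 0 r = 0 by rewrite e def_r r0 raddf0 add0r.
have := congr1 (skewcoef m) e; rewrite {1}def_r mulrDr (raddfD (skewcoef m)) /=.
rewrite skewcoefMC skewcoefMX skewcoefXM fm mul1r der1 addr0 => /eqP.
by rewrite -{1}[X in X == _]add0r (inj_eq (addIr _)) => /eqP.
Qed.

Lemma sp0_der_coef i : D (skewcoef i f) = 0.
Proof.
have /eqP := congr1 (skewcoef i) sp0_commX.
rewrite skewcoefMX skewcoefXM -{1}[X in X == _]addr0 (inj_eq (addrI _)).
by by move=> /eqP.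
Qed.

Lemma sp0_coef_commX i :
  skewC D (skewcoef i f) * skewX D = skewX D * skewC D (skewcoef i f).
Proof. by rewrite skewCX sp0_der_coef raddf0 addr0. Qed.

End NormalMonic.

(* The derivation R -> A over a ring morphism R -> A that vanishes on B *)
(* and maps X to a given z.                                             *)
Section SkewDiff.
Variables (B : pzRingType) (D : derivation B) (A : pzRingType).
Variables (phi : {rmorphism skewpoly D -> A}) (z : A).
Hypothesis zC : forall b, phi (skewC D b) * z = z * phi (skewC D b).
Local Notation x := (phi (skewX D)).

Definition skew_diffX (k : nat) : A := \sum_(0 <= j < k) x ^+ (k.-1 - j) * z * x ^+ j.

Lemma skew_diffXS k : skew_diffX k.+1 = skew_diffX k * x + x ^+ k * z.
Proof.
rewrite /skew_diffX big_nat_recl //= subn0 expr0 mulr1 addrC; congr (_ + _).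
rewrite mulr_suml; apply: eq_big_nat => j /andP[_ jk].
by rewrite -[RHS]mulrA -exprSr; case: k jk => //= k _; rewrite subSS.
Qed.

Lemma skew_diffXSl k : skew_diffX k.+1 = x * skew_diffX k + z * x ^+ k.
Proof.
rewrite /skew_diffX big_nat_recr //= subnn expr0 mul1r; congr (_ + _).
rewrite mulr_sumr; apply: eq_big_nat => j /andP[_ jk].
rewrite !mulrA -exprS; congr (_ ^+ _ * _ * _).
by case: k jk => // k; rewrite ltnS /= => /subSn.
Qed.

Definition skew_diff (p : skewpoly D) : A :=
  malg_sum (fun k c => skew_diffX k * phi (skewC D c)) p.

Let hD k : {morph (fun c => skew_diffX k * phi (skewC D c)) : a b / a + b}.
Proof. by move=> a b; rewrite !raddfD /= mulrDr. Qed.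

Lemma skew_diffD : {morph skew_diff : p q / p + q}.
Proof. by move=> p q; apply: malg_sumD. Qed.

Lemma skew_diff0 : skew_diff 0 = 0.
Proof. exact: malg_sum0. Qed.

Lemma skew_diffXnC k c :
  skew_diff (skewX D ^+ k * skewC D c) = skew_diffX k * phi (skewC D c).
Proof. by rewrite skewXnC /skew_diff malg_sumU. Qed.

Lemma skew_diffXn k : skew_diff (skewX D ^+ k) = skew_diffX k.
Proof. by rewrite -[X in skew_diff X]mulr1 -(rmorph1 (@skewC B D)) skew_diffXnC !rmorph1 mulr1. Qed.

Lemma skew_diffMC p c : skew_diff (p * skewC D c) = skew_diff p * phi (skewC D c).
Proof.
elim/skewpoly_ind: p => [|a k p IH]; first by rewrite mul0r skew_diff0 mul0r.
rewrite mulrDl !skew_diffD IH mulrDl -mulrA -rmorphM !skew_diffXnC.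
by rewrite -mulrA -!rmorphM.
Qed.

Lemma skew_diffMX p : skew_diff (p * skewX D) = skew_diff p * x + phi p * z.
Proof.
elim/skewpoly_ind: p => [|a k p IH].
  by rewrite rmorph0 !mul0r skew_diff0 mul0r addr0.
rewrite !mulrDl !skew_diffD IH rmorphD !mulrDl addrACA; congr (_ + _).
rewrite -mulrA skewCX mulrDr mulrA -exprSr skew_diffD !skew_diffXnC skew_diffXS.
have ax : phi (skewC D a) * x = x * phi (skewC D a) + phi (skewC D (D a)).
  by rewrite -!rmorphM -rmorphD skewCX.
by rewrite mulrDl rmorphM rmorphXn /= -!mulrA ax zC mulrDr addrAC.
Qed.

Lemma skew_diffCM b p : skew_diff (skewC D b * p) = phi (skewC D b) * skew_diff p.
Proof.
have dXn k : skew_diff (skewC D b * skewX D ^+ k) = phi (skewC D b) * skew_diffX k.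
  elim: k => [|k IH].
    by rewrite expr0 mulr1 -[skewC D b]mul1r skew_diffMC -(expr0 (skewX D)) skew_diffXn
      /skew_diffX !big_geq // mulr0 mul0r.
  rewrite exprSr mulrA skew_diffMX IH skew_diffXS mulrDr !mulrA.
  by rewrite rmorphM rmorphXn.
elim/skewpoly_ind: p => [|a k p IH]; first by rewrite mulr0 skew_diff0 mulr0.
by rewrite mulrDr !skew_diffD IH mulrDr mulrA skew_diffMC dXn skew_diffXnC mulrA.
Qed.

Lemma skew_diffXM p : skew_diff (skewX D * p) = x * skew_diff p + z * phi p.
Proof.
elim/skewpoly_ind: p => [|a k p IH].
  by rewrite rmorph0 !mulr0 skew_diff0 mulr0 addr0.
rewrite !mulrDr !skew_diffD IH rmorphD !mulrDr addrACA; congr (_ + _).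
rewrite mulrA -exprS !skew_diffXnC skew_diffXSl mulrDl -!mulrA.
by rewrite rmorphM rmorphXn.
Qed.

End SkewDiff.

Section SkewQuot.
Variables (B : pzRingType) (D : derivation B) (m : nat) (f : skewpoly0 D m).

Definition skewquot := ringquot (normal_ideal (sp0_normal f)).
HB.instance Definition _ := GRing.PzRing.on skewquot.

Definition sq_pi : {rmorphism skewpoly D -> skewquot} :=
  @rqpi _ (normal_ideal (sp0_normal f)).

Definition sqX : skewquot := sq_pi (skewX D).
Definition sqC : {rmorphism B -> skewquot} := sq_pi \o @skewC B D.
Local Notation x := sqX.
Local Notation A := skewquot.

Lemma sq_pi_eq0 p : sq_pi p = 0 <-> exists q, p = sp0_poly f * q.
Proof.
apply: (iff_trans (B := p \in rideal (sp0_poly f))); last by split=> /rideal_predP.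
by rewrite -[p in p \in _]subr0 -(raddf0 sq_pi); apply: rqpi_eqP.
Qed.

Lemma sqC_inj : (0 < m)%N -> injective sqC.
Proof.
move=> m0 b c /eqP; rewrite -subr_eq0 -raddfB => /eqP/sq_pi_eq0[q e].
apply/eqP; rewrite -subr_eq0; apply/eqP; have [tb t0] := skewtopC D (b - c).
have t : skewtop (m + 0) 0 (sp0_poly f * q).
  by rewrite -e; split=> [|i]; [apply: t0|move=> /(leq_ltn_trans _) lt; apply/t0/lt];
    rewrite ?addn0.
have tq := skewtop_quot (sp0_monic f) t.
by rewrite -tb e (skewtopE tq) big_ord1 tq.1 raddf0 !mulr0 raddf0.
Qed.

Lemma sq_piE p : exists q, sq_pi q = p :> A.
Proof. by exists (rqrepr p); apply: rqreprK. Qed.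

Local Notation V := (centralizer sqC).
Local Notation CA := (center A).

Definition I_x (z : A) : A := z * x - x * z.
Definition tau_coef (j : nat) : A := \sum_(j <= k < m) x ^+ (k - j) * sqC (skewcoef k.+1 f).
Definition tau (z : A) : A := \sum_(0 <= j < m) tau_coef j * z * x ^+ j.

Lemma sqCX b : sqC b * x = x * sqC b + sqC (D b).
Proof. by rewrite /sqC /= -!rmorphM -rmorphD skewCX. Qed.

Lemma I_x_centralizer (v : V) : I_x (val v) \in centralizer_pred sqC.
Proof.
apply/centralizer_predP => b; rewrite /I_x mulrBr mulrBl.
have -> : sqC b * (val v * x) = val v * (x * sqC b) + val v * sqC (D b).
  by rewrite mulrA centralizerP -mulrA sqCX mulrDr.
have -> : sqC b * (x * val v) = x * (val v * sqC b) + val v * sqC (D b).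
  by rewrite mulrA sqCX mulrDl -mulrA !centralizerP.
by rewrite opprD addrACA subrr addr0 !mulrA.
Qed.

Lemma tauE (v : V) : tau (val v) = skew_diff sq_pi (val v) f.
Proof.
have commv k : sqC (skewcoef k f) * val v = val v * sqC (skewcoef k f).
  exact: centralizerP.
have commx k : sqC (skewcoef k f) * x = x * sqC (skewcoef k f).
  by rewrite sqCX sp0_der_coef raddf0 addr0.
have commxj k j : sqC (skewcoef k f) * x ^+ j = x ^+ j * sqC (skewcoef k f).
  by elim: j => [|j IH]; rewrite ?mulr1 ?mul1r // exprSr mulrA IH -[LHS]mulrA commx mulrA.
rewrite [in RHS](skewtopE (sp0_monic f)).
have -> : skew_diff sq_pi (val v) (\sum_(i < m.+1) skewX D ^+ i * skewC D (skewcoef i f))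
   = \sum_(i < m.+1) skew_diffX sq_pi (val v) i * sqC (skewcoef i f).
  elim/big_ind2: _ => [|p a q b <- <-|i _]; first exact: skew_diff0.
    exact: skew_diffD.
  exact: skew_diffXnC.
rewrite big_ord_recl {1}/skew_diffX big_geq // mul0r add0r.
pose T k j := x ^+ (k - j) * sqC (skewcoef k.+1 f) * val v * x ^+ j.
transitivity (\sum_(j < m) \sum_(k < m | (j <= k)%N) T k j).
  rewrite /tau big_mkord; apply: eq_bigr => j _.
  by rewrite /tau_coef !mulr_suml big_geq_mkord.
rewrite (exchange_big_dep xpredT) //=; apply: eq_bigr => k _.
rewrite /skew_diffX big_mkord mulr_suml.
rewrite (big_ord_widen _ (fun j : nat => x ^+ (k - j) * val v * x ^+ j *
  sqC (skewcoef k.+1 f)) (ltn_ord k)).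
apply: eq_big => j; first by rewrite ltnS.
by move=> _; rewrite /T -!mulrA -commxj [sqC _ * (val v * _)]mulrA commv !mulrA.
Qed.

Lemma tau_center (v : V) : tau (val v) \in centralizer_pred (idfun : {rmorphism A -> A}).
Proof.
have f0 : sq_pi (sp0_poly f) = 0 by apply/sq_pi_eq0; exists 1; rewrite mulr1.
apply/centralizer_predP => a /=; rewrite tauE; set t := skew_diff _ _ _.
have tC b : sqC b * t = t * sqC b.
  rewrite /t -skew_diffMC -sp0_commC; apply/esym/skew_diffCM => c.
  exact: (centralizerP v).
have tx : x * t = t * x.
  have := congr1 (skew_diff sq_pi (val v)) (sp0_commX f).
  rewrite skew_diffMX ?skew_diffXM ?f0 ?mulr0 ?mul0r ?addr0 // => c.
  exact: (centralizerP v).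
have [p <-] := sq_piE a; elim/skewpoly_ind: p => [|c k p IH].
  by rewrite rmorph0 mulr0 mul0r.
rewrite rmorphD mulrDr mulrDl IH; congr (_ + _).
rewrite rmorphM rmorphXn /= -!/(sqC _) -/sqX.
rewrite -mulrA tC mulrA [RHS]mulrA; congr (_ * _); clear IH.
by elim: k => [|k IHk]; rewrite ?mulr1 ?mul1r // exprSr -mulrA tx mulrA IHk mulrA.
Qed.

Definition I_xV (v : V) : V := Centralizer (I_x_centralizer v).
Definition tauV (v : V) : CA := Centralizer (tau_center v).

Lemma I_xV_is_zmod_morphism : zmod_morphism I_xV.
Proof.
move=> u v; apply: val_inj; rewrite raddfB /= /I_x raddfB /= mulrBl mulrBr.
by rewrite !opprD !opprK addrACA.
Qed.

Lemma tauV_is_zmod_morphism : zmod_morphism tauV.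
Proof.
move=> u v; apply: val_inj; rewrite -[LHS]/(tau (val u - val v)).
rewrite -[RHS]/(tau (val u) - tau (val v)) /tau -sumrB.
by apply: eq_bigr => j _; rewrite mulrBr mulrBl.
Qed.

HB.instance Definition _ := GRing.isZmodMorphism.Build V V I_xV I_xV_is_zmod_morphism.
HB.instance Definition _ := GRing.isZmodMorphism.Build V CA tauV tauV_is_zmod_morphism.

Lemma I_x_linear (c : CA) (v : V) :
  I_x (val c * val v) = val c * I_x (val v) /\
  I_x (val v * val c) = I_x (val v) * val c.
Proof.
have cx a : a * val c = val c * a := centralizerP c a.
by split; rewrite /I_x ?mulrBl ?mulrBr ?mulrA -?cx // -!mulrA ?cx // !mulrA ?cx.
Qed.

Lemma tau_linear (c : CA) (v : V) :
  tau (val c * val v) = val c * tau (val v) /\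
  tau (val v * val c) = tau (val v) * val c.
Proof.
have cx a : a * val c = val c * a := centralizerP c a.
split; rewrite /tau ?mulr_sumr ?mulr_suml; apply: eq_bigr => j _.
  by rewrite !mulrA cx.
by rewrite -!mulrA -cx !mulrA.
Qed.

Definition separable_in : Prop := separable sqC.
Definition weakly_separable_in : Prop := weakly_separable sqC.

End SkewQuot.

Arguments I_xV {B D m} f v.
Arguments tauV {B D m} f v.

(* Main.v *)
Require Import Defs.
From HB Require Import structures.
From mathcomp Require Import all_boot all_order all_algebra.
From mathcomp Require Import boolp.

(** Let [pi : R -> A] be the projection and [x] the class of [X].

    Weak separability.  A derivation of [A] that vanishes on [B] is determined
    by the image [v] of [x], which lies in [V] because [b x - x b] is in [B].
    Conversely, [v] in [V] defines the [pi]-derivation [R -> A] with [X |-> v]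
    ([skew_diff]); it passes to [A = R/fR] exactly when it kills [f], and its
    value at [f] is [tau v] ([tauE]).  The inner derivation of [u] in [V]
    sends [x] to [I_x u].  Hence the [B]-derivations of [A] form the kernel of
    [tau] and the inner ones the image of [I_x], which is the first equivalence
    ([weakly_separableP]).

    Separability.  The same calculus with values in the bimodule
    [A ⊗_B A] and [X |-> 1 ⊗ 1] gives a universal differential [univ_diff].
    As [f] commutes with [X] and with [B], the element [e0 := univ_diff f]
    satisfies [a e0 = e0 a] for all [a] in [A]: it is a Casimir element.
    Expanded, [e0 = \sum_j y_j ⊗ x^j] with [y_j := tau_coef j], and inserting
    [v] from [V] in the middle gives [tau v = \sum_j y_j v x^j].  The
    coefficient of [x^(m-1)] is a [B]-[B]-linear form [h : A -> B] with
    [\sum_j h(y_j) x^j = 1].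

    If [tau v = 1], then [\sum_j y_j v ⊗ x^j] is a Casimir element that
    multiplies to [1], so [A/B] is separable.  If [A/B] is separable with
    Casimir element [\sum_i z_i ⊗ w_i] of product [1], then
    [v := \sum_i z_i h(w_i)] lies in [V] and
    [tau v = \sum_(i, j) z_i h(w_i y_j) x^j = \sum_i z_i w_i = 1], because
    [\sum_j h(a y_j) x^j = \sum_j h(y_j) x^j a = a].  So separability means
    that [1] is in the image of [tau] ([separable_tau1]); by linearity over
    the center this says that [tau] is onto.  Exactness at [V] then follows
    from the first part, as separable extensions are weakly separable. *)

Set Implicit Arguments.
Unset Strict Implicit.
Unset Printing Implicit Defensive.

Import GRing.Theory.
Local Open Scope ring_scope.

(** * The bimodule [A ⊗_B A] *)

Section Bimodule.
Variables (B A : pzRingType) (iota : {rmorphism B -> A}).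
Local Notation T := (tensor iota).
Local Notation "z ⊗ w" := (tensor_pure iota z w) (at level 40).

Definition balanced (G : zmodType) (phi : A -> A -> G) : Prop :=
  [/\ forall z1 z2 w, phi (z1 + z2) w = phi z1 w + phi z2 w,
      forall z w1 w2, phi z (w1 + w2) = phi z w1 + phi z w2
    & forall z b w, phi (z * iota b) w = phi z (iota b * w)].

Definition tensor_hom (G : zmodType) (phi : A -> A -> G) (_ : balanced phi) :
  T -> G := tensor_lift phi.

Lemma tensor_hom_pure (G : zmodType) (phi : A -> A -> G) (bal : balanced phi) z w :
  tensor_hom bal (z ⊗ w) = phi z w.
Proof. by case: bal => Dl Dr M; apply: tensor_lift_pure. Qed.

Lemma tensor_hom_is_zmod_morphism (G : zmodType) (phi : A -> A -> G) (bal : balanced phi) :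
  zmod_morphism (tensor_hom bal).
Proof. by case: bal => Dl Dr M; apply: tensor_liftB. Qed.

HB.instance Definition _ (G : zmodType) (phi : A -> A -> G) (bal : balanced phi) :=
  GRing.isZmodMorphism.Build T G (tensor_hom bal) (tensor_hom_is_zmod_morphism bal).

HB.instance Definition _ a :=
  GRing.isZmodMorphism.Build T T (@tensor_lact B A iota a) (@tensor_lactB B A iota a).

(** The right action with the scalar first, so that [tensor_ractr a] is a
    one-argument map that can carry an additive structure. *)
Definition tensor_ractr (a : A) (t : T) : T := tensor_ract t a.

HB.instance Definition _ a :=
  GRing.isZmodMorphism.Build T T (tensor_ractr a) (@tensor_ractB B A iota a).

HB.instance Definition _ :=
  GRing.isZmodMorphism.Build T A (@tensor_mult B A iota) (@tensor_multB B A iota).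

Lemma tensor_ractr_pure a z w : tensor_ractr a (z ⊗ w) = z ⊗ (w * a).
Proof. exact: tensor_ract_pure. Qed.

Lemma tensor_additive_ext (G : zmodType) (F1 F2 : {additive T -> G}) :
  (forall z w, F1 (z ⊗ w) = F2 (z ⊗ w)) -> F1 =1 F2.
Proof.
move=> eqF; elim/tensor_ind => [|t u IHt IHu|//]; first by rewrite !raddf0.
by rewrite !raddfB /= IHt IHu.
Qed.

Lemma tensor_lactM a b (t : T) : tensor_lact (a * b) t = tensor_lact a (tensor_lact b t).
Proof.
elim/tensor_ind: t => [|t u IHt IHu|z w]; first by rewrite !raddf0.
  by rewrite !raddfB /= IHt IHu.
by rewrite !tensor_lact_pure mulrA.
Qed.

Lemma tensor_lact1 (t : T) : tensor_lact 1 t = t.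
Proof.
elim/tensor_ind: t => [|t u IHt IHu|z w]; first by rewrite !raddf0.
  by rewrite !raddfB /= IHt IHu.
by rewrite !tensor_lact_pure mul1r.
Qed.

Lemma tensor_lactDl a b (t : T) : tensor_lact (a + b) t = tensor_lact a t + tensor_lact b t.
Proof.
elim/tensor_ind: t => [|t u IHt IHu|z w]; first by rewrite !raddf0 addr0.
  by rewrite !raddfB /= IHt IHu opprD addrACA.
by rewrite !tensor_lact_pure mulrDl tensorDl.
Qed.

Lemma tensor_lact0 (t : T) : tensor_lact 0 t = 0.
Proof. by apply: (@addrI _ (tensor_lact 0 t)); rewrite -tensor_lactDl !addr0. Qed.

Lemma tensor_pure0l w : 0 ⊗ w = 0 :> T.
Proof. by apply: (@addrI _ (0 ⊗ w)); rewrite -tensorDl !addr0. Qed.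

Lemma tensor_pure0r z : z ⊗ 0 = 0 :> T.
Proof. by apply: (@addrI _ (z ⊗ 0)); rewrite -tensorDr !addr0. Qed.

(** The form in which the product rule is used below: there [y] is the class
    of [f]. *)
Lemma tensor_add_pure0 y (t u : T) : y = 0 -> t + 1 ⊗ y = u + y ⊗ 1 -> t = u.
Proof. by move->; rewrite tensor_pure0l tensor_pure0r !addr0. Qed.

Lemma tensor_ractrM a b (t : T) :
  tensor_ractr (a * b) t = tensor_ractr b (tensor_ractr a t).
Proof.
elim/tensor_ind: t => [|t u IHt IHu|z w]; first by rewrite !raddf0.
  by rewrite !raddfB /= IHt IHu.
by rewrite !tensor_ractr_pure mulrA.
Qed.

Lemma tensor_ractr1 (t : T) : tensor_ractr 1 t = t.
Proof.
elim/tensor_ind: t => [|t u IHt IHu|z w]; first by rewrite !raddf0.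
  by rewrite !raddfB /= IHt IHu.
by rewrite !tensor_ractr_pure mulr1.
Qed.

Lemma tensor_ractrDl a b (t : T) :
  tensor_ractr (a + b) t = tensor_ractr a t + tensor_ractr b t.
Proof.
elim/tensor_ind: t => [|t u IHt IHu|z w]; first by rewrite !raddf0 addr0.
  by rewrite !raddfB /= IHt IHu opprD addrACA.
by rewrite !tensor_ractr_pure mulrDr tensorDr.
Qed.

Lemma tensor_ractr0 (t : T) : tensor_ractr 0 t = 0.
Proof. by apply: (@addrI _ (tensor_ractr 0 t)); rewrite -tensor_ractrDl !addr0. Qed.

Lemma tensor_lact_ractr a b (t : T) :
  tensor_lact a (tensor_ractr b t) = tensor_ractr b (tensor_lact a t).
Proof.
elim/tensor_ind: t => [|t u IHt IHu|z w]; first by rewrite !raddf0.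
  by rewrite !raddfB /= IHt IHu.
by rewrite tensor_ractr_pure !tensor_lact_pure tensor_ractr_pure.
Qed.

(** * The trivial extension *)

(** A derivation [d] of [R] with values in the bimodule [A ⊗_B A] is the same
    as the derivation [p |-> (0, d p)] with values in the trivial extension
    [A ⋉ (A ⊗_B A)], along [p |-> (pi p, 0)].  As the trivial extension is a
    ring, [skew_diff] thus covers bimodule-valued derivations. *)
Definition trivext := (A * T)%type.
HB.instance Definition _ := GRing.Zmodule.on trivext.

Definition trivext_mul (p q : trivext) : trivext :=
  (p.1 * q.1, tensor_lact p.1 q.2 + tensor_ractr q.1 p.2).

Lemma trivext_mulA : associative trivext_mul.
Proof.
move=> [a t] [b u] [c v]; congr (_, _) => /=; first by rewrite mulrA.
by rewrite !raddfD /= tensor_lactM tensor_ractrM tensor_lact_ractr addrA.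
Qed.

Lemma trivext_mul1p : left_id (1, 0) trivext_mul.
Proof.
by move=> [a t]; rewrite /trivext_mul /= mul1r tensor_lact1 raddf0 addr0.
Qed.

Lemma trivext_mulp1 : right_id (1, 0) trivext_mul.
Proof.
by move=> [a t]; rewrite /trivext_mul /= mulr1 tensor_ractr1 raddf0 add0r.
Qed.

Lemma trivext_mulDl : left_distributive trivext_mul +%R.
Proof.
move=> [a t] [b u] [c v]; congr (_, _) => /=; first by rewrite mulrDl.
by rewrite raddfD /= tensor_lactDl addrACA.
Qed.

Lemma trivext_mulDr : right_distributive trivext_mul +%R.
Proof.
move=> [a t] [b u] [c v]; congr (_, _) => /=; first by rewrite mulrDr.
by rewrite raddfD /= tensor_ractrDl addrACA.
Qed.

HB.instance Definition _ := GRing.Zmodule_isPzRing.Build trivext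
  trivext_mulA trivext_mul1p trivext_mulp1 trivext_mulDl trivext_mulDr.

Lemma trivext_mulE (p q : trivext) :
  p * q = (p.1 * q.1, tensor_lact p.1 q.2 + tensor_ractr q.1 p.2).
Proof. by []. Qed.

Definition trivext_inl (a : A) : trivext := (a, 0).

Lemma trivext_inl_is_zmod_morphism : zmod_morphism trivext_inl.
Proof. by move=> a b; congr (_, _); rewrite /= subr0. Qed.

Lemma trivext_inl_is_monoid_morphism : monoid_morphism trivext_inl.
Proof.
by split=> // a b; rewrite trivext_mulE /= !raddf0 addr0.
Qed.

HB.instance Definition _ :=
  GRing.isZmodMorphism.Build A trivext trivext_inl trivext_inl_is_zmod_morphism.
HB.instance Definition _ :=
  GRing.isMonoidMorphism.Build A trivext trivext_inl trivext_inl_is_monoid_morphism.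

Definition trivext_der (p : trivext) : T := p.2.

Lemma trivext_der_is_zmod_morphism : zmod_morphism trivext_der.
Proof. by []. Qed.

HB.instance Definition _ :=
  GRing.isZmodMorphism.Build trivext T trivext_der trivext_der_is_zmod_morphism.

Lemma trivext_derD p q : trivext_der (p + q) = trivext_der p + trivext_der q.
Proof. by []. Qed.

Lemma trivext_der_inlM a p :
  trivext_der (trivext_inl a * p) = tensor_lact a (trivext_der p).
Proof. by rewrite trivext_mulE /trivext_der /= raddf0 addr0. Qed.

Lemma trivext_der_Minl a p :
  trivext_der (p * trivext_inl a) = tensor_ractr a (trivext_der p).
Proof. by rewrite trivext_mulE /trivext_der /= raddf0 add0r. Qed.

Definition trivext_11 : trivext := (0, 1 ⊗ 1).

Lemma trivext_der_11 : trivext_der trivext_11 = 1 ⊗ 1.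
Proof. by []. Qed.

(** The element [1 ⊗ 1] commutes with [B], so it may be prescribed as the
    differential of [X]. *)
Lemma trivext_11C b : trivext_inl (iota b) * trivext_11 = trivext_11 * trivext_inl (iota b).
Proof.
rewrite !trivext_mulE /= mulr0 mul0r !raddf0 addr0 add0r; congr (_, _).
by rewrite tensor_lact_pure tensor_ractr_pure mulr1 mul1r -{1}[iota b]mul1r tensorM mulr1.
Qed.

(** * Casimir elements and separability *)

Section Commutes.
Variable t : T.
Definition commutes a : Prop := tensor_lact a t = tensor_ractr a t.

Lemma commutes0 : commutes 0.
Proof. by rewrite /commutes tensor_lact0 tensor_ractr0. Qed.

Lemma commutesD a b : commutes a -> commutes b -> commutes (a + b).
Proof. by rewrite /commutes tensor_lactDl tensor_ractrDl => -> ->. Qed.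

Lemma commutesM a b : commutes a -> commutes b -> commutes (a * b).
Proof.
rewrite /commutes tensor_lactM tensor_ractrM => <- ->.
by rewrite tensor_lact_ractr.
Qed.

Lemma commutesX a k : commutes a -> commutes (a ^+ k).
Proof.
move=> ca; elim: k => [|k IH]; last by rewrite exprS; apply: commutesM.
by rewrite /commutes tensor_lact1 tensor_ractr1.
Qed.
End Commutes.

Definition casimir (e : T) : Prop := forall a, commutes e a.

Lemma tensor_mult_lact a (t : T) : tensor_mult (tensor_lact a t) = a * tensor_mult t.
Proof.
elim/tensor_ind: t => [|t u IHt IHu|z w]; first by rewrite !raddf0 mulr0.
  by rewrite !raddfB /= IHt IHu mulrBr.
by rewrite tensor_lact_pure !tensor_mult_pure mulrA.
Qed.

(** A bimodule map out of [A] is determined by the image of [1], which can be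
    any Casimir element. *)
Lemma separableP :
  separable iota <-> exists e : T, casimir e /\ tensor_mult e = 1.
Proof.
split=> [[s [sl sr sm]]|[e [ce e1]]].
  by exists (s 1); split=> // a; rewrite /commutes -sl mulr1 /tensor_ractr -sr mul1r.
pose s z := tensor_lact z e.
have sB : zmod_morphism s.
  by move=> a b; apply: (@addIr _ (s b)); rewrite -tensor_lactDl !subrK.
pose sM := GRing.isZmodMorphism.Build A T s sB.
pose S : {additive A -> T} := HB.pack s sM.
exists S; split=> [a z|z a|z] /=; first exact: tensor_lactM.
  by rewrite /s tensor_lactM ce tensor_lact_ractr.
by rewrite tensor_mult_lact e1 mulr1.
Qed.

(** If [\sum_i z_i w_i = 1] for the Casimir element [\sum_i z_i ⊗ w_i], a
    derivation [d] over [B] is inner, given by [\sum_i d(z_i) w_i]. *)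
Lemma separable_weakly_separable : separable iota -> weakly_separable iota.
Proof.
move=> /separableP[e [ce e1]] d dB.
have bal : balanced (fun z w => d z * w).
  split=> [z1 z2 w|z w1 w2|z b w]; first by rewrite raddfD mulrDl.
    by rewrite mulrDr.
  by rewrite derM dB mulr0 addr0 mulrA.
have homl a t : tensor_hom bal (tensor_lact a t) =
    d a * tensor_mult t + a * tensor_hom bal t.
  elim/tensor_ind: t => [|t u IHt IHu|z w]; first by rewrite !raddf0 !mulr0 addr0.
    by rewrite !raddfB /= IHt IHu !mulrBr opprD addrACA.
  by rewrite tensor_lact_pure tensor_mult_pure !tensor_hom_pure derM mulrDl !mulrA.
have homr a t : tensor_hom bal (tensor_ractr a t) = tensor_hom bal t * a.
  elim/tensor_ind: t => [|t u IHt IHu|z w]; first by rewrite !raddf0 mul0r.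
    by rewrite !raddfB /= IHt IHu mulrBl.
  by rewrite tensor_ractr_pure !tensor_hom_pure mulrA.
exists (tensor_hom bal e) => a.
by rewrite -homr -ce homl e1 mulr1 addrK.
Qed.

Lemma insert_balanced (v : centralizer iota) : balanced (fun z w => z * val v * w).
Proof.
split=> [z1 z2 w|z w1 w2|z b w]; rewrite ?mulrDl ?mulrDr //.
by rewrite -[z * iota b * val v]mulrA centralizerP !mulrA.
Qed.

Lemma insertT_balanced (v : centralizer iota) : balanced (fun z w => (z * val v) ⊗ w).
Proof.
split=> [z1 z2 w|z w1 w2|z b w]; rewrite ?mulrDl ?tensorDl ?tensorDr //.
by rewrite -mulrA centralizerP mulrA tensorM.
Qed.

(** Inserting [v] in the middle of a Casimir element keeps it Casimir, as the
    actions of [A] are on the outer sides. *)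
Lemma separable_of_insert (e0 : T) (v : centralizer iota) : casimir e0 ->
  tensor_hom (insert_balanced v) e0 = 1 -> separable iota.
Proof.
move=> ce e1; apply/separableP; exists (tensor_hom (insertT_balanced v) e0).
have homl a t : tensor_lact a (tensor_hom (insertT_balanced v) t) =
    tensor_hom (insertT_balanced v) (tensor_lact a t).
  elim/tensor_ind: t => [|t u IHt IHu|z w]; first by rewrite !raddf0.
    by rewrite !raddfB /= IHt IHu.
  by rewrite tensor_lact_pure !tensor_hom_pure tensor_lact_pure mulrA.
have homr a t : tensor_ractr a (tensor_hom (insertT_balanced v) t) =
    tensor_hom (insertT_balanced v) (tensor_ractr a t).
  elim/tensor_ind: t => [|t u IHt IHu|z w]; first by rewrite !raddf0.
    by rewrite !raddfB /= IHt IHu.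
  by rewrite tensor_ractr_pure !tensor_hom_pure tensor_ractr_pure.
split=> [a|]; first by rewrite /commutes homl homr ce.
rewrite -e1; elim/tensor_ind: e0 {ce e1} => [|t u IHt IHu|z w]; first by rewrite !raddf0.
  by rewrite !raddfB /= IHt IHu.
by rewrite !tensor_hom_pure tensor_mult_pure.
Qed.

Lemma insert_ractr (v : centralizer iota) a t :
  tensor_hom (insert_balanced v) (tensor_ractr a t) = tensor_hom (insert_balanced v) t * a.
Proof.
elim/tensor_ind: t => [|t u IHt IHu|z w]; first by rewrite !raddf0 mul0r.
  by rewrite !raddfB /= IHt IHu mulrBl.
by rewrite tensor_ractr_pure !tensor_hom_pure mulrA.
Qed.

(** A [B]-[B]-linear form [h] on [A], and a Casimir element
    [e0 = \sum_j y_j ⊗ x_j] with [\sum_j h(y_j) x_j = 1]: one half of a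
    Frobenius structure on [A/B]. *)
Section Frobenius.
Variable h : {additive A -> B}.
Hypotheses (hMl : forall b a, h (iota b * a) = b * h a)
           (hMr : forall a b, h (a * iota b) = h a * b).

Lemma form_l_balanced : balanced (fun z w => iota (h z) * w).
Proof.
split=> [z1 z2 w|z w1 w2|z b w]; rewrite ?raddfD ?mulrDl ?mulrDr //.
by rewrite hMr rmorphM mulrA.
Qed.

Lemma form_r_balanced : balanced (fun z w => z * iota (h w)).
Proof.
split=> [z1 z2 w|z w1 w2|z b w]; rewrite ?raddfD ?mulrDl ?mulrDr //.
by rewrite hMl rmorphM mulrA.
Qed.

Local Notation L := (tensor_hom form_l_balanced).
Local Notation H := (tensor_hom form_r_balanced).

Lemma form_l_ractr a t : L (tensor_ractr a t) = L t * a.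
Proof.
elim/tensor_ind: t => [|t u IHt IHu|z w]; first by rewrite !raddf0 mul0r.
  by rewrite !raddfB /= IHt IHu mulrBl.
by rewrite tensor_ractr_pure !tensor_hom_pure mulrA.
Qed.

Lemma form_r_lact a t : H (tensor_lact a t) = a * H t.
Proof.
elim/tensor_ind: t => [|t u IHt IHu|z w]; first by rewrite !raddf0 mulr0.
  by rewrite !raddfB /= IHt IHu mulrBr.
by rewrite tensor_lact_pure !tensor_hom_pure mulrA.
Qed.

(** With [H e = \sum_i z_i h(w_i)], one has
    [b (H e) = H (b e) = H (e b) = (H e) b]. *)
Lemma form_r_centralizer e : casimir e -> H e \in centralizer_pred iota.
Proof.
move=> ce; apply/centralizer_predP => b; rewrite -form_r_lact ce.
elim/tensor_ind: e {ce} => [|t u IHt IHu|z w]; first by rewrite !raddf0 mul0r.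
  by rewrite !raddfB /= IHt IHu mulrBl.
by rewrite tensor_ractr_pure !tensor_hom_pure hMr rmorphM mulrA.
Qed.

(** Contracting with [h] turns a Casimir element [e = \sum_i z_i ⊗ w_i] into
    the element [v = \sum_i z_i h(w_i)] of the centralizer, and
    [\sum_j y_j v x_j = \sum_(i, j) z_i h(w_i y_j) x_j = \sum_i z_i w_i],
    first by [y_j e = e y_j] and then by
    [\sum_j h(w_i y_j) x_j = \sum_j h(y_j) x_j w_i = w_i]. *)
Lemma insert_of_separable (e0 : T) : casimir e0 -> L e0 = 1 -> separable iota ->
  exists v : centralizer iota, tensor_hom (insert_balanced v) e0 = 1.
Proof.
move=> ce0 Le0 /separableP[e [ce e1]].
exists (Centralizer (form_r_centralizer ce)).
have mid_balanced t : balanced (fun z' w' => H (tensor_ractr z' t) * w').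
  split=> [z1 z2 w|z w1 w2|z b w]; rewrite ?tensor_ractrDl ?raddfD ?mulrDl ?mulrDr //.
  rewrite mulrA; congr (_ * _).
  elim/tensor_ind: t => [|t u IHt IHu|z' w']; first by rewrite !raddf0 mul0r.
    by rewrite !raddfB /= IHt IHu mulrBl.
  by rewrite !tensor_ractr_pure !tensor_hom_pure mulrA hMr rmorphM mulrA.
have -> : tensor_hom (insert_balanced (Centralizer (form_r_centralizer ce))) e0
    = tensor_hom (mid_balanced e) e0.
  apply: tensor_additive_ext => z w.
  by rewrite /= !tensor_hom_pure -ce form_r_lact.
(* The double sum is computed for an arbitrary tensor [t] in place of [e], so
   that it reduces to pure tensors. *)
have mulL t : tensor_hom (mid_balanced t) e0 = tensor_mult t.
  elim/tensor_ind: t => [|t u IHt IHu|z w].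
  - rewrite [RHS]raddf0; elim/tensor_ind: {ce0 Le0} e0 => [|t u IHt IHu|z w].
    + by rewrite raddf0.
    + by rewrite raddfB /= IHt IHu subrr.
    + by rewrite tensor_hom_pure !raddf0 mul0r.
  - rewrite [RHS]raddfB /= -IHt -IHu.
    elim/tensor_ind: {ce0 Le0 IHt IHu} e0 => [|t' u' IHt IHu|z w].
    + by rewrite !raddf0 addr0.
    + by rewrite !raddfB /= IHt IHu !opprD !opprK addrACA.
    + by rewrite !tensor_hom_pure !raddfB mulrBl.
  - rewrite tensor_mult_pure -[w in RHS]mul1r -Le0 -form_l_ractr -ce0.
    elim/tensor_ind: {ce0 Le0} e0 => [|t u IHt IHu|z' w'].
    + by rewrite !raddf0 mulr0.
    + by rewrite !raddfB /= IHt IHu mulrBr.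
    + by rewrite tensor_lact_pure !tensor_hom_pure tensor_ractr_pure tensor_hom_pure mulrA.
by rewrite mulL.
Qed.
End Frobenius.
End Bimodule.

(** * Differentials of skew polynomials *)

Section SkewDiffMore.
Variables (B : pzRingType) (D : derivation B) (A : pzRingType).
Variable phi : {rmorphism skewpoly D -> A}.

Lemma skew_diffM z : (forall b, phi (skewC D b) * z = z * phi (skewC D b)) ->
  forall p q, skew_diff phi z (p * q) =
    skew_diff phi z p * phi q + phi p * skew_diff phi z q.
Proof.
move=> zC p q.
have dXn k : skew_diff phi z (p * skewX D ^+ k) =
    skew_diff phi z p * phi (skewX D ^+ k) + phi p * skew_diff phi z (skewX D ^+ k).
  elim: k => [|k IH].
    rewrite expr0 rmorph1 !mulr1 -(expr0 (skewX D)) skew_diffXn.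
    by rewrite /skew_diffX big_geq // mulr0 addr0.
  rewrite exprSr mulrA !skew_diffMX // IH rmorphM mulrDl !mulrDr !rmorphM /=.
  by rewrite -!mulrA !addrA.
elim/skewpoly_ind: q => [|c k q IH].
  by rewrite rmorph0 !mulr0 skew_diff0 mulr0 addr0.
rewrite mulrDr !skew_diffD IH rmorphD !mulrDr addrACA; congr (_ + _).
by rewrite mulrA !skew_diffMC dXn mulrDl rmorphM !mulrA.
Qed.

Lemma skew_diff_unique z (d : {additive skewpoly D -> A}) :
  (forall p q, d (p * q) = d p * phi q + phi p * d q) ->
  (forall b, d (skewC D b) = 0) -> d (skewX D) = z -> d =1 skew_diff phi z.
Proof.
move=> dM dC dX.
have dXn k : d (skewX D ^+ k) = skew_diffX phi z k.
  elim: k => [|k IH]; last by rewrite exprSr dM IH dX skew_diffXS rmorphXn.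
  by rewrite expr0 -(rmorph1 (@skewC B D)) dC /skew_diffX big_geq.
elim/skewpoly_ind => [|c k p IH]; first by rewrite raddf0 skew_diff0.
by rewrite raddfD skew_diffD IH skew_diffXnC /= dM dXn dC mulr0 addr0.
Qed.

End SkewDiffMore.

(** * Derivations of the quotient *)

Section Quot.
Variables (B : pzRingType) (D : derivation B) (m : nat) (f : skewpoly0 D m).
Local Notation A := (skewquot f).
Local Notation pi := (sq_pi f).
Local Notation x := (sqX f).
Local Notation iota := (sqC f).
Local Notation V := (centralizer iota).

Lemma sq_pi_f : pi (sp0_poly f) = 0.
Proof. by apply/sq_pi_eq0; exists 1; rewrite mulr1. Qed.

Lemma derivation_skew_diff (d : derivation A) : (forall b, d (iota b) = 0) ->
  forall p, d (pi p) = skew_diff pi (d x) p.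
Proof.
move=> dB; apply: (@skew_diff_unique _ _ _ pi (d x) (d \o pi)) => //= p q.
by rewrite rmorphM derM.
Qed.

Lemma commutator_skew_diff (u : V) p :
  skew_diff pi (I_x (val u)) p = val u * pi p - pi p * val u.
Proof.
pose d p := val u * pi p - pi p * val u.
have dB : zmod_morphism d.
  by move=> p1 q; rewrite /d rmorphB mulrBr mulrBl opprD addrACA -opprD.
pose dA := GRing.isZmodMorphism.Build _ _ d dB.
pose dd : {additive skewpoly D -> A} := HB.pack d dA.
rewrite -(@skew_diff_unique _ _ _ pi _ dd) // => [p1 q|b] /=.
  by rewrite /d !rmorphM mulrBl mulrBr !mulrA addrA subrK.
by rewrite /d -[pi (skewC D b)]/(iota b) centralizerP subrr.
Qed.

(** By [tauE] this is the commutator of [u] with the class of [f], which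
    is [0]. *)
Lemma tau_I_x (u : V) : tau (I_x (val u)) = 0.
Proof.
rewrite -[I_x _]/(val (I_xV f u)) tauE /= commutator_skew_diff sq_pi_f.
by rewrite mulr0 mul0r subrr.
Qed.

(** By the product rule, [skew_diff] kills [f R] as soon as it kills [f]. *)
Lemma derivation_of_tau0 (v : V) : tau (val v) = 0 ->
  exists d : derivation A, (forall b, d (iota b) = 0) /\ d x = val v.
Proof.
rewrite tauE => tv0.
have vC b : pi (skewC D b) * val v = val v * pi (skewC D b) := centralizerP v b.
pose d0 (a : A) := skew_diff pi (val v) (rqrepr a).
have d0pi p : d0 (pi p) = skew_diff pi (val v) p.
  have [q e] : exists q, rqrepr (pi p) - p = sp0_poly f * q.
    apply/sq_pi_eq0; rewrite rmorphB; apply/eqP; rewrite subr_eq0; apply/eqP.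
    exact: rqreprK.
  rewrite /d0 -[rqrepr _](subrK p) e skew_diffD skew_diffM // tv0 sq_pi_f.
  by rewrite !mul0r !add0r.
have dB : zmod_morphism d0.
  move=> a b; have [p <-] := sq_piE a; have [q <-] := sq_piE b.
  rewrite -rmorphB !d0pi; apply: (@addIr _ (skew_diff pi (val v) q)).
  by rewrite -skew_diffD !subrK.
pose dA := GRing.isZmodMorphism.Build _ _ d0 dB.
pose dd : {additive A -> A} := HB.pack d0 dA.
have dM a b : dd (a * b) = dd a * b + a * dd b.
  have [p <-] := sq_piE a; have [q <-] := sq_piE b.
  by rewrite -rmorphM /= !d0pi skew_diffM.
exists (Derivation dM); split=> [b|] /=.
  rewrite d0pi -[skewC D b]mul1r -(expr0 (skewX D)) skew_diffXnC.
  by rewrite /skew_diffX big_geq ?mul0r.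
rewrite d0pi -[skewX D]expr1 skew_diffXn /skew_diffX big_nat1 /= expr0.
by rewrite mul1r mulr1.
Qed.

(** Apply [d] to [b x = x b + D b]. *)
Lemma derivation_centralizer (d : derivation A) : (forall b, d (iota b) = 0) ->
  d x \in centralizer_pred iota.
Proof.
move=> dB; apply/centralizer_predP => b.
have := congr1 d (sqCX f b).
by rewrite raddfD /= !derM !dB mul0r mulr0 addr0 add0r addr0.
Qed.

Lemma weakly_separableP : weakly_separable_in f <-> exact_seq (I_xV f) (tauV f).
Proof.
split=> [ws v|ex d dB].
  split=> [tv0|[u ->]]; last by apply: val_inj; apply: tau_I_x.
  have [d [dB dx]] : exists d : derivation A, (forall b, d (iota b) = 0) /\ d x = val v.
    exact/derivation_of_tau0/(congr1 val tv0).
  have [u du] := ws d dB.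
  have uV : u \in centralizer_pred iota.
    apply/centralizer_predP => b; apply/esym/eqP; rewrite -subr_eq0.
    by rewrite -du dB.
  by exists (Centralizer uV); apply: val_inj; rewrite /= -dx du.
pose v : V := Centralizer (derivation_centralizer dB).
have tv0 : tauV f v = 0.
  apply: val_inj; rewrite [LHS](tauE v) /= -derivation_skew_diff // sq_pi_f.
  by rewrite raddf0.
have [u vu] := (ex v).1 tv0; exists (val u) => a.
have dx : d x = I_x (val u) := congr1 val vu.
have [p <-] := sq_piE a.
by rewrite -(commutator_skew_diff u) (derivation_skew_diff dB) dx.
Qed.

(** * The universal differential *)

Local Notation T := (tensor iota).
Local Notation "z ⊗ w" := (tensor_pure iota z w) (at level 40).

Definition univ_phi : {rmorphism skewpoly D -> trivext iota} :=
  @trivext_inl _ _ iota \o pi.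
Local Notation univ_z := (trivext_11 iota).
Definition univ_diff (p : skewpoly D) : T := trivext_der (skew_diff univ_phi univ_z p).

Lemma univ_zC b : univ_phi (skewC D b) * univ_z = univ_z * univ_phi (skewC D b).
Proof. exact: trivext_11C. Qed.

Lemma univ_diffMC p b : univ_diff (p * skewC D b) = tensor_ractr (iota b) (univ_diff p).
Proof. by rewrite /univ_diff skew_diffMC trivext_der_Minl. Qed.

Lemma univ_diffCM p b : univ_diff (skewC D b * p) = tensor_lact (iota b) (univ_diff p).
Proof. by rewrite /univ_diff (skew_diffCM univ_zC) trivext_der_inlM. Qed.

Lemma univ_diffMX p : univ_diff (p * skewX D) =
  tensor_ractr x (univ_diff p) + pi p ⊗ 1.
Proof.
rewrite /univ_diff (skew_diffMX univ_zC) trivext_derD.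
congr (_ + _); first exact: trivext_der_Minl.
by rewrite trivext_der_inlM trivext_der_11 tensor_lact_pure mulr1.
Qed.

Lemma univ_diffXM p : univ_diff (skewX D * p) =
  tensor_lact x (univ_diff p) + 1 ⊗ pi p.
Proof.
rewrite /univ_diff skew_diffXM trivext_derD.
congr (_ + _); first exact: trivext_der_inlM.
by rewrite trivext_der_Minl trivext_der_11 tensor_ractr_pure mul1r.
Qed.

Lemma univ_diffD p q : univ_diff (p + q) = univ_diff p + univ_diff q.
Proof. by rewrite /univ_diff skew_diffD trivext_derD. Qed.

Lemma univ_diff0 : univ_diff 0 = 0.
Proof. by rewrite /univ_diff skew_diff0 (raddf0 (@trivext_der _ _ iota)). Qed.

Lemma univ_diff1 : univ_diff 1 = 0.
Proof.
by rewrite /univ_diff -(expr0 (skewX D)) skew_diffXn /skew_diffX big_geq.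
Qed.

(** Differentiating [b f = f b] and [X f = f X] gives commutation with [B] and
    with [x]: the remaining terms of the product rule contain the class of
    [f].  Together [B] and [x] generate [A]. *)
Lemma univ_diff_f_casimir : casimir (univ_diff f).
Proof.
have cC b : commutes (univ_diff f) (iota b).
  apply: etrans (esym (univ_diffCM _ _)) (etrans _ (univ_diffMC _ _)).
  by congr univ_diff; apply: sp0_commC.
have cX : commutes (univ_diff f) x.
  apply: (tensor_add_pure0 sq_pi_f).
  apply: etrans (esym (univ_diffXM _)) (etrans _ (univ_diffMX _)).
  by congr univ_diff; apply: sp0_commX.
move=> a; have [p <-] := sq_piE a; elim/skewpoly_ind: p => [|c k p IH].
  by rewrite rmorph0; apply: commutes0.
rewrite rmorphD; apply: commutesD IH; rewrite rmorphM rmorphXn.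
exact: commutesM (commutesX k cX) (cC c).
Qed.

(** Universality: [z ⊗ w |-> z v w] carries the differential with
    [X |-> 1 ⊗ 1] to the one with [X |-> v]. *)
Lemma insert_univ_diff (v : V) p :
  tensor_hom (insert_balanced v) (univ_diff p) = skew_diff pi (val v) p.
Proof.
have Xn k : tensor_hom (insert_balanced v) (univ_diff (skewX D ^+ k)) =
    skew_diffX pi (val v) k.
  elim: k => [|k IH]; first by rewrite univ_diff1 /skew_diffX !big_geq // raddf0.
  rewrite exprSr univ_diffMX raddfD /= insert_ractr IH skew_diffXS.
  by rewrite tensor_hom_pure mulr1 rmorphXn.
elim/skewpoly_ind: p => [|c k p IH]; first by rewrite univ_diff0 skew_diff0 raddf0.
rewrite univ_diffD (raddfD (tensor_hom (insert_balanced v))).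
rewrite skew_diffD skew_diffXnC -IH -Xn.
by congr (_ + _); rewrite univ_diffMC; apply: insert_ractr.
Qed.

(** * The top coefficient *)

Hypothesis m_gt0 : (0 < m)%N.

Definition reduced (r : skewpoly D) : Prop := forall i, (m <= i)%N -> skewcoef i r = 0.

Lemma reducedD r s : reduced r -> reduced s -> reduced (r + s).
Proof. by move=> rr rs i mi; rewrite raddfD /= rr // rs // addr0. Qed.

Lemma reduced_eq0 r : reduced r -> pi r = 0 -> r = 0.
Proof.
move=> rr /sq_pi_eq0[q e].
have t : skewtop (m + 0) 0 (sp0_poly f * q).
  by rewrite -e addn0; split=> [|i /ltnW]; apply: rr.
have tq := skewtop_quot (sp0_monic f) t.
by rewrite e (skewtopE tq) big_ord1 tq.1 raddf0 !mulr0.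
Qed.

Lemma reduced_inj r s : reduced r -> reduced s -> pi r = pi s -> r = s.
Proof.
move=> rr rs e; apply/eqP; rewrite -subr_eq0; apply/eqP/reduced_eq0.
  by move=> i mi; rewrite raddfB /= rr // rs // subrr.
by rewrite rmorphB e subrr.
Qed.

(** Division by the monic [f]; multiplying a remainder by [X] raises the degree
    by at most one, so a single multiple of [f] has to be subtracted. *)
Lemma reduced_ex (a : A) : exists r, reduced r /\ pi r = a.
Proof.
have [p <-] := sq_piE a; elim/skewpoly_ind: p {a} => [|c k p [r [rr rp]]].
  by exists 0; split=> // i _; rewrite raddf0.
suff [s [rs es]] : exists s, reduced s /\ pi s = pi (skewX D ^+ k * skewC D c).
  by exists (s + r); split; [exact: reducedD|rewrite !rmorphD rp es].
elim: k => [|k [s [rs e]]].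
  exists (skewC D c); rewrite expr0 mul1r; split=> // i mi.
  by apply: (skewtopC D c).2; apply: leq_trans mi.
pose s' := skewX D * s; pose b := skewcoef m s'.
exists (s' - sp0_poly f * skewC D b); split=> [i|]; last first.
  rewrite rmorphB [pi (sp0_poly f * _)]rmorphM sq_pi_f mul0r subr0 /s' exprS.
  by rewrite -mulrA !(rmorphM pi (skewX D)) e.
have [fm fgt] := sp0_monic f.
rewrite raddfB /= skewcoefMC leq_eqVlt => /predU1P[<-|mi].
  by rewrite fm mul1r subrr.
rewrite fgt // mul0r subr0 /s' skewcoefXM.
by case: i mi => // i; rewrite ltnS => /rs.
Qed.

Definition remainder (a : A) : skewpoly D := projT1 (cid (reduced_ex a)).

Lemma remainder_reduced a : reduced (remainder a).
Proof. by rewrite /remainder; case: cid => r []. Qed.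

Lemma remainderK a : pi (remainder a) = a.
Proof. by rewrite /remainder; case: cid => r []. Qed.

Lemma remainder_pi r : reduced r -> remainder (pi r) = r.
Proof.
by move=> rr; apply: reduced_inj; rewrite ?remainderK //; apply: remainder_reduced.
Qed.

Definition topcoef (a : A) : B := skewcoef m.-1 (remainder a).

Lemma topcoef_is_zmod_morphism : zmod_morphism topcoef.
Proof.
move=> a b; rewrite /topcoef.
have rab : reduced (remainder a - remainder b).
  by move=> i mi; rewrite raddfB /= !remainder_reduced // subrr.
have -> : remainder (a - b) = remainder a - remainder b.
  by rewrite -(remainder_pi rab) rmorphB !remainderK.
by rewrite raddfB.
Qed.
HB.instance Definition _ :=
  GRing.isZmodMorphism.Build A B topcoef topcoef_is_zmod_morphism.

Lemma topcoef_mulr a b : topcoef (a * iota b) = topcoef a * b.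
Proof.
rewrite /topcoef; have rab : reduced (remainder a * skewC D b).
  by move=> i mi; rewrite skewcoefMC remainder_reduced // mul0r.
have -> : remainder (a * iota b) = remainder a * skewC D b.
  by rewrite -(remainder_pi rab) rmorphM remainderK.
by rewrite skewcoefMC.
Qed.

(** Left multiplication by [b] does not raise degrees, and [b X^k] has leading
    term [X^k b], so it multiplies the top coefficient by [b] on the left. *)
Lemma topcoef_mull b a : topcoef (iota b * a) = b * topcoef a.
Proof.
have ta : skewtop m.-1 (topcoef a) (remainder a).
  by split=> // i; rewrite (prednK m_gt0); apply: remainder_reduced.
have [tb tgt] := skewtopM (skewtopC D b) ta; rewrite add0n in tb tgt.
have rba : reduced (skewC D b * remainder a).
  by move=> i; rewrite -{1}(prednK m_gt0); apply: tgt.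
rewrite {1}/topcoef; have -> : remainder (iota b * a) = skewC D b * remainder a.
  by rewrite -(remainder_pi rba) rmorphM remainderK.
by [].
Qed.

Lemma topcoefXn k : (k < m)%N -> topcoef (x ^+ k) = (k == m.-1)%:R.
Proof.
move=> km; have Xk : skewX D ^+ k = skewX D ^+ k * skewC D 1 by rewrite rmorph1 mulr1.
have rX : reduced (skewX D ^+ k).
  by move=> i mi; rewrite Xk skewcoefXnC (ltn_eqF (leq_trans km mi)).
by rewrite /topcoef /sqX -rmorphXn (remainder_pi rX) Xk skewcoefXnC.
Qed.

(** For [k <= m], the differential of [X^k] is
    [\sum_(j < k) x^(k-1-j) ⊗ x^j], and only [j = 0] with [k = m] has the
    exponent [m-1] on the left.  So in [f] only the leading term survives. *)
Lemma right_linear_univ_diff (F : {additive T -> A}) :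
    (forall a t, F (tensor_ractr a t) = F t * a) ->
    (forall k, (k < m)%N -> F (x ^+ k ⊗ 1) = (k == m.-1)%:R) ->
  F (univ_diff f) = 1.
Proof.
move=> FM F1.
have Xn k : (k <= m)%N -> F (univ_diff (skewX D ^+ k)) = (k == m)%:R.
  elim: k => [|k IH] km; first by rewrite univ_diff1 raddf0 (ltn_eqF m_gt0).
  rewrite exprSr univ_diffMX raddfD FM IH ?(ltnW km) // (ltn_eqF km) mul0r add0r.
  by rewrite rmorphXn F1 // -eqSS (prednK m_gt0).
rewrite [sp0_poly f](skewtopE (sp0_monic f)) big_ord_recr /=.
have Fterm k c : (k <= m)%N ->
    F (univ_diff (skewX D ^+ k * skewC D c)) = (k == m)%:R * iota c.
  by move=> km; rewrite univ_diffMC FM Xn.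
have [fm _] := sp0_monic f; rewrite fm univ_diffD raddfD -[RHS]add0r.
congr (_ + _); last by rewrite Fterm // eqxx rmorph1 mulr1.
elim/big_ind: _ => [|p q Fp Fq|i _].
    by rewrite univ_diff0 (raddf0 F).
  rewrite univ_diffD (raddfD F).
  exact: etrans (congr2 +%R Fp Fq) (addr0 0).
by rewrite Fterm ?(ltnW (ltn_ord i)) // (ltn_eqF (ltn_ord i)) mul0r.
Qed.

Lemma form_l_univ_diff : tensor_hom (form_l_balanced topcoef_mulr) (univ_diff f) = 1.
Proof.
apply: right_linear_univ_diff => [a t|k km]; first exact: form_l_ractr.
apply: etrans (tensor_hom_pure (form_l_balanced topcoef_mulr) _ _) _.
apply: etrans (mulr1 _) _; rewrite -(rmorph_nat iota); congr (iota _).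
exact: topcoefXn.
Qed.

(** * The two equivalences *)

Lemma separable_tau1 : separable_in f <-> exists v : V, tau (val v) = 1.
Proof.
split=> [|[v tv]].
  case/(insert_of_separable topcoef_mull univ_diff_f_casimir form_l_univ_diff) => v.
  by rewrite insert_univ_diff -tauE; exists v.
apply: (separable_of_insert (v := v) univ_diff_f_casimir).
by rewrite insert_univ_diff -tauE.
Qed.

Lemma centralizer_mul_center (c : center A) (v : V) :
  val c * val v \in centralizer_pred iota.
Proof.
have cc a : a * val c = val c * a := centralizerP c a.
by apply/centralizer_predP => b; rewrite mulrA cc -mulrA centralizerP mulrA.
Qed.

(** [tau] is linear over the center, and [tau v = 1] gives [tau (c v) = c]. *)
Lemma tauV_onto : (exists v : V, tau (val v) = 1) <->
  (forall c : center A, exists v : V, tauV f v = c).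
Proof.
split=> [[v tv] c|onto].
  exists (Centralizer (centralizer_mul_center c v)); apply: val_inj => /=.
  by rewrite (tau_linear c v).1 tv mulr1.
have c1 : 1 \in centralizer_pred (idfun : {rmorphism A -> A}).
  by apply/centralizer_predP => a; rewrite mulr1 mul1r.
by have [v e] := onto (Centralizer c1); exists v; apply: (congr1 val e).
Qed.
End Quot.

Theorem theorem3p11 (B : pzRingType) (D : derivation B) (m : nat)
    (m_ge1 : (1 <= m)%N) (f : skewpoly0 D m) :
  (weakly_separable_in f <-> exact_seq (I_xV f) (tauV f)) /\
  (separable_in f <-> right_exact_seq (I_xV f) (tauV f)).
Proof.
split; first exact: weakly_separableP.
split=> [sep|[_ onto]]; last exact/(separable_tau1 _ m_ge1)/tauV_onto.
split; first exact/weakly_separableP/separable_weakly_separable.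
exact/tauV_onto/(separable_tau1 _ m_ge1).
Qed.
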